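(* Let $r\geq 1$ and let $G$ be an $r$-regular graph. Then $G$ has a perfect $[1,2]$-factor and thus $o(G)=\mathcal{D}$. Moreover, a winning strategy for Dominator can be computed in polynomial time.
   Context: All graphs are finite and simple. A graph is $r$-regular if all its vertices have degree $r$. A perfect $[1,2]$-factor of a graph $G$ is a spanning subgraph of $G$ (a subgraph with the same vertex set) each of whose connected components is either a single edge $K_2$ or a cycle $C_n$, $n\ge 3$. The Maker-Breaker domination game on a graph $G$: two players, Dominator and Staller, alternately claim a not-yet-claimed vertex of $G$. Dominator wins if at some point the vertices she has claimed form a dominating set of $G$ (a set $S$ with $S\cap N[v]\neq\emptyset$ for every vertex $v$, where $N[v]$ is the closed neighborhood of $v$). Otherwise, i.e. if Staller manages to claim a vertex and all its neighbors, Staller wins. The graph $G$ has outcome $\mathcal{D}$, written $o(G)=\mathcal{D}$, if Dominator has a winning strategy whoever starts (equivalently, if Dominator has a winning strategy when playing second, since no player benefits from skipping a turn). Computing a winning strategy means computing Dominator's winning moves, as second player, in response to the moves of Staller. *)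

(* Defs.v *)
From mathcomp Require Import all_boot.
Set Implicit Arguments.
Unset Strict Implicit.
Unset Printing Implicit Defensive.

(** * Graphs *)

Record sgraph := SGraph {
  vertex :> finType;
  edge : rel vertex;
  edge_sym : symmetric edge;
  edge_irrefl : irreflexive edge }.

Definition regular (r : nat) (G : sgraph) : Prop :=
  forall x : G, #|[set y | edge x y]| = r.

Definition cycle_edge (n : nat) : rel 'I_n :=
  fun i j => (j == i.+1 %% n :> nat) || (i == j.+1 %% n :> nat).

Definition complete_edge (n : nat) : rel 'I_n := fun i j => i != j.

(* The subgraph of (T, f) induced on A is isomorphic to the graph (S, d). *)
Definition induced_iso (T S : finType) (f : rel T) (A : {set T}) (d : rel S) :
  Prop :=
  exists g : S -> T,
    [/\ injective g, [set g i | i : S] = A & forall i j, f (g i) (g j) = d i j].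

Definition component (T : finType) (f : rel T) (x : T) : {set T} :=
  [set y | connect f x y].

(* A spanning subgraph of G is given by its adjacency relation f. *)
Definition perfect_12_factor (G : sgraph) (f : rel G) : Prop :=
  [/\ symmetric f,
      subrel f (@edge G)
    & forall x : G,
        induced_iso f (component f x) (@complete_edge 2)
        \/ exists2 n, 3 <= n & induced_iso f (component f x) (@cycle_edge n)].

(** * The Maker-Breaker domination game *)

Inductive player := Dominator | Staller.

Definition closed_nbhd (G : sgraph) (v : G) : {set G} :=
  [set u | (u == v) || edge v u].

Definition dominating (G : sgraph) (S : {set G}) : bool :=
  [forall v, S :&: closed_nbhd v != set0].

(* A position is the duplicate-free sequence h of all the vertices claimed so
   far, by either player, in chronological order. *)
Definition dominator_turn (first : player) (T : Type) (h : seq T) : bool :=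
  if first is Dominator then ~~ odd (size h) else odd (size h).

Definition dominator_set (G : sgraph) (first : player) (h : seq G) : {set G} :=
  [set x in h | dominator_turn first (take (index x h) h)].

(* None means that no move is proposed; it makes strategies exist on the empty
   graph too. *)
Definition strategy (G : sgraph) := seq G -> option G.

Definition follows (G : sgraph) (first : player) (sigma : strategy G)
    (h : seq G) : Prop :=
  forall h1 x h2,
    h = h1 ++ x :: h2 -> dominator_turn first h1 -> sigma h1 = Some x.

(* As long as Dominator has not won yet, the board is not exhausted and, on her
   turn, sigma gives an unclaimed vertex.  Plays being finite, this says that
   every play following sigma reaches a position where her vertices form a
   dominating set. *)
Definition winning (G : sgraph) (first : player) (sigma : strategy G) : Prop :=
  forall h : seq G, uniq h -> follows first sigma h ->
    ~~ dominating (dominator_set first h) ->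
    size h < #|G| /\
    (dominator_turn first h -> exists2 v, v \notin h & sigma h = Some v).

Definition outcome_D (G : sgraph) : Prop :=
  forall first : player, exists sigma : strategy G, winning first sigma.

(** * Polynomial time *)

(* A structured random access machine with unbounded natural-number cells.
   The memory consists of arrays numbered by nat; Get a e is cell e of array a.
   A program mentions finitely many arrays, by fixed number, and a scalar
   variable is cell 0 of an array.  The only arithmetic is addition and
   truncated subtraction: in t steps the bit length of the values grows by
   O(t), so that unit-cost time is polynomially related to Turing machine time,
   which would fail with a unit-cost multiplication. *)
Inductive expr :=
| Const of nat
| Get of nat & expr
| Add of expr & expr
| Sub of expr & expr.

Inductive cmd :=
| Skip
| Set_ of nat & expr & expr  (* Set_ a i e is the assignment a[i] := e *)
| Seq of cmd & cmd
| If of expr & cmd & cmd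
| While of expr & cmd.

Definition memory := nat -> nat -> nat.

Fixpoint eval (m : memory) (e : expr) : nat :=
  match e with
  | Const k => k
  | Get a e1 => m a (eval m e1)
  | Add e1 e2 => eval m e1 + eval m e2
  | Sub e1 e2 => eval m e1 - eval m e2
  end.

Fixpoint cost (e : expr) : nat :=
  match e with
  | Const _ => 1
  | Get _ e1 => (cost e1).+1
  | Add e1 e2 | Sub e1 e2 => (cost e1 + cost e2).+1
  end.

Definition update (m : memory) (a i v : nat) : memory :=
  fun b j => if (b == a) && (j == i) then v else m b j.

(* exec c m t m' : run from memory m, the command c halts in memory m' after
   exactly t steps.  Tests succeed on nonzero values. *)
Inductive exec : cmd -> memory -> nat -> memory -> Prop :=
| ExecSkip m : exec Skip m 1 m
| ExecSet m a i e :
    exec (Set_ a i e) m (cost i + cost e).+1 (update m a (eval m i) (eval m e))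
| ExecSeq c1 c2 m t1 m1 t2 m2 :
    exec c1 m t1 m1 -> exec c2 m1 t2 m2 ->
    exec (Seq c1 c2) m (t1 + t2).+1 m2
| ExecIfTrue e c1 c2 m t m' :
    eval m e != 0 -> exec c1 m t m' ->
    exec (If e c1 c2) m (cost e + t).+1 m'
| ExecIfFalse e c1 c2 m t m' :
    eval m e = 0 -> exec c2 m t m' ->
    exec (If e c1 c2) m (cost e + t).+1 m'
| ExecWhileTrue e c m t1 m1 t2 m2 :
    eval m e != 0 -> exec c m t1 m1 -> exec (While e c) m1 t2 m2 ->
    exec (While e c) m (cost e + t1 + t2).+1 m2
| ExecWhileFalse e c m :
    eval m e = 0 -> exec (While e c) m (cost e).+1 m.

(* Vertices are numbered from 0 by enum_rank.  The input consists of
   array 0: the number n of vertices (cell 0);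
   array 1: the adjacency matrix, entry (x, y) in cell x * n + y;
   array 2: the number of vertices claimed so far (cell 0);
   array 3: the claimed vertices in chronological order. *)
Definition input (G : sgraph) (h : seq G) : memory := fun a i =>
  match a with
  | 0 => if i == 0 then #|G| else 0
  | 1 => [exists x : G, exists y : G,
            edge x y && (i == enum_rank x * #|G| + enum_rank y)]
  | 2 => if i == 0 then size h else 0
  | 3 => nth 0 [seq (enum_rank x : nat) | x <- h] i
  | _ => 0
  end.

(* The output is read in cell 0 of array 4. *)
Definition move_code (G : sgraph) (o : option G) : nat :=
  if o is Some v then (enum_rank v).+1 else 0.

(* On every position where Dominator, playing second, is to move, the program
   outputs the move prescribed by sigma within time (bound #|G|).  As #|G| is
   at most the size of the input, and the size of the input is polynomial in
   #|G|, a polynomial bound in #|G| is a polynomial bound in the input size. *)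
Definition computes_within (prog : cmd) (bound : nat -> nat) (G : sgraph)
    (sigma : strategy G) : Prop :=
  forall h : seq G, uniq h -> dominator_turn Staller h ->
    exists t m,
      [/\ exec prog (input h) t m, t <= bound #|G| & m 4 0 = move_code (sigma h)].

(* Main.v *)
From mathcomp Require Import all_boot.
From mathcomp Require Import zify.
Require Import Defs.

(** A regular graph has a permutation pi with x adjacent to pi x for all x, since
    its bipartite double cover has a perfect matching; the orbits of pi are the
    components of a perfect [1,2]-factor.  Dominator answers a move v by pi v if
    it is free, otherwise by any free neighbour of v, otherwise by any free
    vertex.

    The permutation is computed by an auction: an unmatched left vertex x takes
    over its cheapest neighbour y, whose price then increases by one.  By Hall's
    condition no price exceeds the number n of vertices, so that the auction ends
    after at most n^2 bids; that it ends also shows that pi exists. *)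

Set Implicit Arguments.
Unset Strict Implicit.
Unset Printing Implicit Defensive.

(** * Polynomially bounded functions *)

Definition poly_bounded (f : nat -> nat) :=
  exists c d, forall n, f n <= c * n.+1 ^ d.

Lemma poly_bounded_const k : poly_bounded (fun=> k).
Proof. by exists k, 0 => n; rewrite muln1. Qed.

Lemma poly_bounded_id : poly_bounded id.
Proof. by exists 1, 1 => n; rewrite mul1n leqnSn. Qed.

(** The base [n.+1] is positive, so both exponents can be raised to the common value [d + d']. *)
Lemma poly_bounded_add f g :
  poly_bounded f -> poly_bounded g -> poly_bounded (fun n => f n + g n).
Proof.
move=> [c [d fP]] [c' [d' gP]]; exists (c + c'), (d + d') => n.
rewrite mulnDl; apply: leq_add;
  [apply: leq_trans (fP n) _|apply: leq_trans (gP n) _];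
  by rewrite leq_mul2l leq_pexp2l ?leq_addr ?leq_addl ?orbT.
Qed.

Lemma poly_bounded_mul f g :
  poly_bounded f -> poly_bounded g -> poly_bounded (fun n => f n * g n).
Proof.
move=> [c [d fP]] [c' [d' gP]]; exists (c * c'), (d + d') => n.
by rewrite expnD mulnACA leq_mul.
Qed.

(** Passes to the shape of bound that the theorem asks for. For positive arguments the successor at
    most doubles the base, which costs a factor [2 ^ d]; at 0 the additive constant takes over. *)
Lemma poly_bounded_monomial f :
  poly_bounded f -> exists c d, forall n, f n <= c * n ^ d + c.
Proof.
move=> [c [d fP]]; exists (c * 2 ^ d), d => n; apply: leq_trans (fP n) _.
case: n => [|n].
  by rewrite exp1n muln1 (leq_trans _ (leq_addl _ _))// leq_pmulr// expn_gt0.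
have le_exp : n.+2 ^ d <= (2 * n.+1) ^ d.
  by case: d fP => // d _; rewrite leq_exp2r//; lia.
by rewrite -mulnA -expnMn (leq_trans _ (leq_addr _ _))// leq_mul2l le_exp orbT.
Qed.

(** * Correctness and running time of programs *)

Fixpoint writes (c : cmd) : seq nat :=
  match c with
  | Skip => [::]
  | Set_ a _ _ => [:: a]
  | Seq c1 c2 | If _ c1 c2 => writes c1 ++ writes c2
  | While _ c1 => writes c1
  end.

Fixpoint reads (e : expr) : seq nat :=
  match e with
  | Const _ => [::]
  | Get a e1 => a :: reads e1
  | Add e1 e2 | Sub e1 e2 => reads e1 ++ reads e2
  end.

Fixpoint mentions (c : cmd) : seq nat :=
  match c with
  | Skip => [::]
  | Set_ a i e => a :: reads i ++ reads e
  | Seq c1 c2 => mentions c1 ++ mentions c2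
  | If e c1 c2 => reads e ++ mentions c1 ++ mentions c2
  | While e c1 => reads e ++ mentions c1
  end.

Definition agree_off (W : seq nat) (m m' : memory) :=
  forall a, a \notin W -> m' a =1 m a.

Lemma agree_off_trans W m1 m2 m3 :
  agree_off W m1 m2 -> agree_off W m2 m3 -> agree_off W m1 m3.
Proof. by move=> h12 h23 a aW i; rewrite h23 ?h12. Qed.

Lemma agree_off_sub W W' m m' :
  {subset W <= W'} -> agree_off W m m' -> agree_off W' m m'.
Proof. by move=> sub h a aW; apply: h; apply: contra aW; apply: sub. Qed.

Lemma exec_agree_off c m t m' : exec c m t m' -> agree_off (writes c) m m'.
Proof.
elim=> {c m t m'} //=.
- move=> m a i e b; rewrite inE /update => /negPf ab j.
  by rewrite ab.
- move=> c1 c2 m t1 m1 t2 m2 _ h1 _ h2; apply: (@agree_off_trans _ _ m1);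
    [apply: agree_off_sub h1 | apply: agree_off_sub h2] => a;
    by rewrite mem_cat => ->; rewrite ?orbT.
- move=> e c1 c2 m t m' _ _ h; apply: agree_off_sub h => a.
  by rewrite mem_cat => ->.
- move=> e c1 c2 m t m' _ _ h; apply: agree_off_sub h => a.
  by rewrite mem_cat => ->; rewrite orbT.
- by move=> e c m t1 m1 t2 m2 _ _ h1 _ h2; apply: agree_off_trans h1 h2.
Qed.

Lemma eval_agree (P : pred nat) m1 m2 e :
  (forall a, P a -> m1 a =1 m2 a) -> all P (reads e) -> eval m1 e = eval m2 e.
Proof.
move=> h; elim: e => //= [a e IH /andP[Pa /IH ->]|e1 IH1 e2 IH2|e1 IH1 e2 IH2];
  first exact: h.
- by rewrite all_cat => /andP[/IH1 -> /IH2 ->].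
- by rewrite all_cat => /andP[/IH1 -> /IH2 ->].
Qed.

(** Every test and every assigned value depends only on arrays in [P], so both runs take the same
    branches in the same number of steps. This transfers the auction from the empty position to any
    position. *)
Lemma exec_noninterference (P : pred nat) c m t m' n :
    exec c m t m' -> (forall a, P a -> m a =1 n a) -> all P (mentions c) ->
  exists2 n', exec c n t n' & forall a, P a -> m' a =1 n' a.
Proof.
move=> ex; elim: ex n => {c m t m'} /=.
- by move=> m n h _; exists n => //; apply: ExecSkip.
- move=> m a i e n h /andP[_]; rewrite all_cat => /andP[hi he].
  rewrite (eval_agree h hi) (eval_agree h he).
  eexists; first exact: ExecSet.
  by move=> b Pb j; rewrite /update; case: ifP => // _; apply: h.
- move=> c1 c2 m t1 m1 t2 m2 _ IH1 _ IH2 n h; rewrite all_cat => /andP[h1 h2].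
  have [n1 ex1 hn1] := IH1 _ h h1; have [n2 ex2 hn2] := IH2 _ hn1 h2.
  by exists n2 => //; apply: ExecSeq ex1 ex2.
- move=> e c1 c2 m t m' te _ IH n h; rewrite !all_cat => /and3P[he h1 _].
  have [n' ex hn] := IH _ h h1; exists n' => //; apply: ExecIfTrue ex.
  by rewrite -(eval_agree h he).
- move=> e c1 c2 m t m' te _ IH n h; rewrite !all_cat => /and3P[he _ h1].
  have [n' ex hn] := IH _ h h1; exists n' => //; apply: ExecIfFalse ex.
  by rewrite -(eval_agree h he).
- move=> e c m t1 m1 t2 m2 te _ IH1 _ IH2 n h hc; move: (hc).
  rewrite all_cat => /andP[he h1].
  have [n1 ex1 hn1] := IH1 _ h h1; have [n2 ex2 hn2] := IH2 _ hn1 hc.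
  exists n2 => //; apply: ExecWhileTrue ex1 ex2.
  by rewrite -(eval_agree h he).
- move=> e c m te n h; rewrite all_cat => /andP[he _].
  by exists n => //; apply: ExecWhileFalse; rewrite -(eval_agree h he).
Qed.

(* The running time of c when each entered loop makes at most B iterations. *)
Fixpoint time (B : nat) (c : cmd) : nat :=
  match c with
  | Skip => 1
  | Set_ _ i e => (cost i + cost e).+1
  | Seq c1 c2 => (time B c1 + time B c2).+1
  | If e c1 c2 => (cost e + (time B c1 + time B c2)).+1
  | While e c1 => B * (cost e + time B c1).+1 + (cost e).+1
  end.

Lemma poly_bounded_time (B : nat -> nat) c :
  poly_bounded B -> poly_bounded (fun n => time (B n) c).
Proof.
have add1 f k : poly_bounded f -> poly_bounded (fun n => (k + f n).+1).
  move=> hf; exact: poly_bounded_add (poly_bounded_const k.+1) hf.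
move=> hB; elim: c => [|a i e|c1 IH1 c2 IH2|e c1 IH1 c2 IH2|e c IH] /=.
- exact: poly_bounded_const.
- exact: poly_bounded_const.
- exact: add1 0 (poly_bounded_add IH1 IH2).
- exact: add1 (poly_bounded_add IH1 IH2).
- apply: poly_bounded_add (poly_bounded_const _).
  exact: poly_bounded_mul hB (add1 _ _ IH).
Qed.

(** Total correctness with the syntactic time bound built in: only the iteration counts of loops are
    left to be bounded in proofs. *)
Definition wp (B : nat) (c : cmd) (m : memory) (Q : memory -> Prop) :=
  exists t m', [/\ exec c m t m', t <= time B c & Q m'].

Lemma wp_agree_off B c m (Q : memory -> Prop) :
  wp B c m Q -> wp B c m (fun m' => agree_off (writes c) m m' /\ Q m').
Proof.
move=> [t [m' [ex tB Qm']]]; exists t, m'; split=> //; split=> //.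
exact: exec_agree_off ex.
Qed.

Lemma wp_conseq B c m (P Q : memory -> Prop) :
    wp B c m P -> (forall m', agree_off (writes c) m m' -> P m' -> Q m') ->
  wp B c m Q.
Proof.
move=> /wp_agree_off[t [m' [ex tB [off Pm']]]] h.
by exists t, m'; split=> //; apply: h.
Qed.

Lemma wp_skip B m (Q : memory -> Prop) : Q m -> wp B Skip m Q.
Proof. by move=> Qm; exists 1, m; split=> //; apply: ExecSkip. Qed.

Lemma wp_set B a i e m (Q : memory -> Prop) :
  Q (update m a (eval m i) (eval m e)) -> wp B (Set_ a i e) m Q.
Proof. by move=> Qm; do 2!eexists; split; [apply: ExecSet| |]. Qed.

Lemma wp_seq B c1 c2 m (Q : memory -> Prop) :
  wp B c1 m (fun m' => wp B c2 m' Q) -> wp B (Seq c1 c2) m Q.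
Proof.
move=> [t1 [m1 [ex1 le1 [t2 [m2 [ex2 le2 Qm2]]]]]].
exists (t1 + t2).+1, m2; split=> //; first exact: ExecSeq ex1 ex2.
by rewrite ltnS leq_add.
Qed.

Lemma wp_if B e c1 c2 m (Q : memory -> Prop) :
    (eval m e != 0 -> wp B c1 m Q) -> (eval m e = 0 -> wp B c2 m Q) ->
  wp B (If e c1 c2) m Q.
Proof.
have [e0 _ /(_ e0)|ne0 /(_ isT) + _] := eqVneq (eval m e) 0.
  move=> [t [m' [ex le Qm]]]; exists (cost e + t).+1, m'; split=> //.
    exact: ExecIfFalse.
  by rewrite /= ltnS leq_add2l (leq_trans le) ?leq_addl.
move=> [t [m' [ex le Qm]]]; exists (cost e + t).+1, m'; split=> //.
  exact: ExecIfTrue.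
by rewrite /= ltnS leq_add2l (leq_trans le) ?leq_addr.
Qed.

(** The variant [mu] starts at most at [B] and drops at each iteration, so there are at most [B]
    iterations. The frame condition relative to [m0] is supplied to the body and to the exit, and
    need not be part of [I]. *)
Lemma wp_while B e c m0 (I : memory -> Prop) (mu : memory -> nat)
    (Q : memory -> Prop) :
    I m0 -> mu m0 <= B ->
    (forall m, agree_off (writes c) m0 m -> I m -> eval m e != 0 ->
       wp B c m (fun m' => I m' /\ mu m' < mu m)) ->
    (forall m, agree_off (writes c) m0 m -> I m -> eval m e = 0 -> Q m) ->
  wp B (While e c) m0 Q.
Proof.
move=> I0 mu0 body exit.
suff: forall k m, mu m <= k -> agree_off (writes c) m0 m -> I m ->
    exists t m', [/\ exec (While e c) m t m',
      t <= k * (cost e + time B c).+1 + (cost e).+1 & Q m'].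
  move=> /(_ (mu m0) m0 (leqnn _)) [//|//|t [m' [ex le Qm]]].
  exists t, m'; split=> //; apply: leq_trans le _.
  by rewrite leq_add2r leq_mul2r mu0 orbT.
elim=> [|k IH] m mum off Im; have [e0|ne0] := eqVneq (eval m e) 0.
- by exists (cost e).+1, m; split; [apply: ExecWhileFalse|lia|apply: exit].
- have [t [m' [_ _ [_]]]] := body m off Im ne0; lia.
- by exists (cost e).+1, m; split; [apply: ExecWhileFalse|lia|apply: exit].
have [t1 [m1 [ex1 le1 [off1 [I1 mu1]]]]] := wp_agree_off (body m off Im ne0).
have mu1k : mu m1 <= k by lia.
have [t2 [m2 [ex2 le2 Qm2]]] := IH m1 mu1k (agree_off_trans off off1) I1.
exists (cost e + t1 + t2).+1, m2; split=> //; first exact: ExecWhileTrue ex1 ex2.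
by rewrite mulSn; lia.
Qed.

Definition for_ (i b : nat) (c : cmd) : cmd :=
  Seq (Set_ i (Const 0) (Const 0))
      (While (Sub (Get b (Const 0)) (Get i (Const 0)))
         (Seq c (Set_ i (Const 0) (Add (Get i (Const 0)) (Const 1))))).

(** The variant is the remaining distance to the bound. Neither the body nor the counter update
    touches [b], and the body leaves [i] alone, which is why [m' i 0 = k] may be assumed after
    it. *)
Lemma wp_for B i b c m0 (I : nat -> memory -> Prop) (Q : memory -> Prop) :
    m0 b 0 <= B -> i \notin writes c -> b \notin i :: writes c ->
    I 0 (update m0 i 0 0) ->
    (forall k m, k < m0 b 0 -> agree_off (i :: writes c) m0 m ->
       m i 0 = k -> I k m ->
       wp B c m (fun m' => m' i 0 = k -> I k.+1 (update m' i 0 k.+1))) ->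
    (forall m, agree_off (i :: writes c) m0 m -> I (m0 b 0) m -> Q m) ->
  wp B (for_ i b c) m0 Q.
Proof.
move=> leB ic bc I0 body exit; apply/wp_seq/wp_set => /=.
have off0 m : agree_off (writes (Seq c (Set_ i (Const 0) (Const 0))))
    (update m0 i 0 0) m -> agree_off (i :: writes c) m0 m.
  move=> off a; rewrite inE negb_or => /andP[ai ac] j.
  by rewrite off ?mem_cat ?inE ?negb_or ?ai ?ac// /update (negPf ai).
apply: (@wp_while _ _ _ _ (fun m => m i 0 <= m0 b 0 /\ I (m i 0) m)
          (fun m => m0 b 0 - m i 0)).
- by rewrite /update !eqxx.
- by rewrite (leq_trans (leq_subr _ _)).
- move=> m /off0 off [_ Im] /=; rewrite (off b bc) => lt_m.
  apply/wp_seq/(wp_conseq (body _ m _ off erefl Im)); first by lia.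
  move=> m' off' Im'; apply: wp_set => /=.
  rewrite (off' i ic) addn1 /update !eqxx /=; split; last by lia.
  by split; [lia|apply: Im'; exact: off'].
- move=> m /off0 off [le_m Im] /=; rewrite (off b bc) => m_eq.
  by apply: exit => //; have <- : m i 0 = m0 b 0 by lia.
Qed.

(** The counter runs through the ranks, hence through [enum G] in order; the invariant is indexed by
    the prefix already visited, so that no arithmetic on ranks reaches the applications. *)
Lemma wp_foreach (G : finType) B i b c m0 (I : seq G -> memory -> Prop)
    (Q : memory -> Prop) :
    m0 b 0 = #|G| -> #|G| <= B -> i \notin writes c -> b \notin i :: writes c ->
    I [::] (update m0 i 0 0) ->
    (forall s x m, agree_off (i :: writes c) m0 m -> m i 0 = enum_rank x ->
       I s m ->
       wp B c m (fun m' => m' i 0 = enum_rank x ->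
                   I (rcons s x) (update m' i 0 (enum_rank x).+1))) ->
    (forall m, agree_off (i :: writes c) m0 m -> I (enum G) m -> Q m) ->
  wp B (for_ i b c) m0 Q.
Proof.
move=> bG leB ic bc I0 body exit.
apply: (@wp_for _ _ _ _ _ (fun k => I (take k (enum G)))) => //; rewrite ?bG //.
- by rewrite take0.
- move=> k m kG off mi Ik.
  pose x := enum_val (Ordinal kG).
  have xk : enum_rank x = k :> nat by rewrite enum_valK.
  apply: wp_conseq (body _ x m off _ Ik) _; first by rewrite mi xk.
  move=> m' _; rewrite xk (take_nth x) ?size_enum -?cardT //.
  have -> : nth x (enum G) k = x by rewrite -xk nth_enum_rank.
  exact.
- by move=> m off; rewrite cardE take_size; apply: exit.
Qed.

(** * Auctions in regular graphs *)

(** Double counting: [r * #|X|] edges leave [X], all of them end in [N], and each vertex of [N]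
    receives at most [r] of them. *)
Lemma regular_hall r (G : sgraph) (X : {set G}) :
  1 <= r -> regular r G -> #|X| <= #|[set y | [exists x in X, edge x y]]|.
Proof.
move=> r_gt0 regG; set N := [set y | _].
rewrite -(leq_pmul2r r_gt0) -!sum_nat_const.
have -> : \sum_(x in X) r = \sum_(x in X) \sum_(y in N) edge x y.
  apply: eq_bigr => x xX; rewrite -(regG x) -sum1_card big_mkcond [RHS]big_mkcond /=.
  apply: eq_bigr => y _; rewrite !inE; case: ifP => exy; last by rewrite if_same.
  by rewrite ifT//; apply/exists_inP; exists x.
rewrite exchange_big; apply: leq_sum => y _.
rewrite -(regG y) -sum1_card [leqRHS]big_mkcond [leqLHS]big_mkcond /=.
by apply: leq_sum => x _; rewrite inE edge_sym; case: ifP => //; case: edge.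
Qed.

(* The left copy of x bids for the right copies of its neighbours: [o y] is the
   current owner of y and [p y] its price, the number of bids made for y. *)
Record auction (G : sgraph) (o : G -> option G) (p : G -> nat) : Prop := Auction {
  auction_inj : forall x y y', o y = Some x -> o y' = Some x -> y = y';
  auction_free : forall y, o y = None -> p y = 0;
  auction_edge : forall x y, o y = Some x -> edge x y;
  auction_greedy : forall x y y', o y = Some x -> edge x y' -> p y <= (p y').+1;
  auction_bounded : forall y, p y <= #|G| }.

(* With R j the vertices of price at least j, the neighbours of the owners of
   R j.+1 and those of x all lie in R j, so that Hall's condition makes #|R j|
   strictly decreasing for j <= p y. *)
Lemma auction_price r (G : sgraph) (o : G -> option G) p x y :
    1 <= r -> regular r G -> auction o p -> (forall y', o y' != Some x) ->
    (forall y', edge x y' -> p y <= p y') -> p y < #|G|.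
Proof.
move=> r_gt0 regG [oinj ofree oedge ogreedy _] xfree ymin.
pose R j := [set y | j <= p y].
pose O j := [set z | [exists y in R j, o y == Some z]].
(* Vertices of positive price are owned, and no two of them by the same owner. *)
have card_O j : #|O j.+1| = #|R j.+1|.
  rewrite -(card_in_imset (f := o) (D := R j.+1)) => [|y1 y2]; last first.
    rewrite !inE => p1 _; case o1: (o y1) => [z|]; first by move/esym; apply: oinj.
    by rewrite (ofree _ o1) in p1.
  rewrite -(card_imset (mem (O j.+1)) (@Some_inj _)); apply: eq_card => u.
  apply/imsetP/imsetP => [[z]|[y1 y1R ->]].
    by rewrite inE => /exists_inP[y1 y1R /eqP <-] ->; exists y1.
  case o1: (o y1) => [z|]; last by rewrite inE (ofree _ o1) in y1R.
  by exists z => //; rewrite inE; apply/exists_inP; exists y1; rewrite ?o1.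
have step j : j < p y -> #|R j.+1| < #|R j|.
  move=> jy; have xO : x \notin O j.+1.
    by rewrite inE; apply/exists_inP => -[y' _]; apply/negP.
  (* The unmatched [x] is not an owner, so adding it to [O j.+1] supplies the extra unit that makes
     the inequality strict. *)
  rewrite -card_O -[_.+1]/(true + #|O j.+1|) -xO -cardsU1.
  apply: leq_trans (regular_hall _ r_gt0 regG) _; apply/subset_leq_card/subsetP => y'.
  rewrite inE => /exists_inP[z]; rewrite !inE => /orP[/eqP->|]; last first.
    case/exists_inP => y1 + /eqP oy1 zy'; rewrite inE => y1R.
    by have := ogreedy _ _ _ oy1 zy'; lia.
  by move=> /ymin; lia.
(* At [j = p y] the set [R j] still contains [y], which gives the strict bound. *)
suff : forall j, j <= p y -> #|R j| + j <= #|G|.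
  move=> /(_ _ (leqnn _)); have : 0 < #|R (p y)|.
    by apply/card_gt0P; exists y; rewrite inE.
  lia.
elim=> [|j IH] jy; first by rewrite addn0 max_card.
by have := step j jy; have := IH (ltnW jy); lia.
Qed.

(** Prices only rise, so greediness persists for the remaining owners; for [x] it holds because [y]
    was a cheapest neighbour. The price bound survives by [auction_price]. *)
Lemma auction_bid r (G : sgraph) (o : G -> option G) p x y :
    1 <= r -> regular r G -> auction o p -> (forall y', o y' != Some x) ->
    edge x y -> (forall y', edge x y' -> p y <= p y') ->
  auction (fun z => if z == y then Some x else o z)
          (fun z => if z == y then (p y).+1 else p z).
Proof.
move=> r_gt0 regG aop xfree exy ymin; case: (aop) => oinj ofree oedge ogreedy obound.
split.
- move=> z y1 y2; case: (eqVneq y1 y) => [->|_]; case: (eqVneq y2 y) => [->|_] //.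
  + by case=> <- /eqP; rewrite (negPf (xfree _)).
  + by move=> /eqP + [xz]; rewrite -xz (negPf (xfree _)).
  + exact: oinj.
- by move=> z; case: eqVneq => // _; apply: ofree.
- by move=> z y1; case: (eqVneq y1 y) => [-> [<-]//|_]; apply: oedge.
- move=> z y1 y2; case: (eqVneq y1 y) => [_ [<-] /ymin|_ /ogreedy h /h];
    by case: eqVneq => [->|]; lia.
- move=> z; case: eqVneq => // _; exact: auction_price r_gt0 regG aop xfree ymin.
Qed.

(** [pi] sends each vertex to what it owns; it is injective because a vertex has at most one
    owner. *)
Lemma auction_perfect (G : sgraph) (o : G -> option G) p :
    auction o p -> (forall x, exists y, o y = Some x) ->
  exists2 pi : G -> G, injective pi /\ (forall x, edge x (pi x))
                     & forall x y, (o y == Some x) = (y == pi x).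
Proof.
move=> [oinj _ oedge _ _] /fin_all_exists[pi opi].
have oE x y : (o y == Some x) = (y == pi x).
  by apply/eqP/eqP => [oy|->]; [apply: oinj oy (opi x)|].
exists pi => //; split=> [x1 x2 eq12|x]; last exact: oedge (opi x).
by apply: Some_inj; rewrite -!opi eq12.
Qed.

(** * Dominator's strategy *)

(** The last hit wins, as in a program loop that overwrites its output; [o] is the value present
    beforehand. *)
Definition pick_last (T : finType) (P : pred T) (o : option T) :=
  foldl (fun b y => if P y then Some y else b) o (enum T).

Variant pick_last_spec (T : finType) (P : pred T) (o : option T) :
    option T -> Prop :=
  | PickLastSome x of P x : pick_last_spec P o (Some x)
  | PickLastNone of (forall x, ~~ P x) : pick_last_spec P o o.

Lemma pick_lastP (T : finType) (P : pred T) o :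
  pick_last_spec P o (pick_last P o).
Proof.
rewrite /pick_last; have: forall x, P x -> x \in enum T by move=> x; rewrite mem_enum.
elim/last_ind: (enum T) => [|s x IH] h /=.
  by right=> x; apply/negP => /h.
rewrite foldl_rcons; case: ifP => [Px|nPx]; first by left.
apply: IH => y Py; move: (h y Py); rewrite mem_rcons inE.
by case/orP=> // /eqP yx; rewrite -yx Py in nPx.
Qed.

(** Inner picks serve as defaults for outer ones, so the outermost has the highest priority. *)
Definition reply (G : sgraph) (next : rel G) (free : pred G) (v : G) : option G :=
  pick_last [pred y | free y & next v y]
    (pick_last [pred y | free y & edge v y] (pick_last free None)).

(* The case h = [::] only arises when Dominator starts. *)
Definition matching_strategy (G : sgraph) (next : rel G) : strategy G :=
  fun h => if h is x :: h' then reply next [predC h] (last x h')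
           else pick_last predT None.

Lemma matching_strategy_free (G : sgraph) (next : rel G) (h : seq G) x :
  x \notin h -> exists2 y, y \notin h & matching_strategy next h = Some y.
Proof.
have pick_free o : (exists2 y, y \notin h & o = Some y) -> forall P : pred G,
    exists2 y, y \notin h & pick_last [pred y | y \notin h & P y] o = Some y.
  by move=> oP P; case: pick_lastP => // y /andP[yh _]; exists y.
case: h pick_free => [|z h] pick_free xh /=.
  by case: pick_lastP => [y _|/(_ x)//]; exists y.
apply/pick_free/pick_free; case: pick_lastP => [y yh|/(_ x)]; first by exists y.
by rewrite /= xh.
Qed.

Lemma dominator_turn_rcons first (T : Type) (h : seq T) x :
  dominator_turn first (rcons h x) = ~~ dominator_turn first h.
Proof. by case: first; rewrite /dominator_turn size_rcons. Qed.

Lemma mem_dominator_set (G : sgraph) first (h1 h2 : seq G) x :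
    uniq (h1 ++ x :: h2) ->
  (x \in dominator_set first (h1 ++ x :: h2)) = dominator_turn first h1.
Proof.
rewrite cat_uniq /= => /and3P[_ /norP[xh1 _] _].
rewrite inE mem_cat mem_head orbT /= index_cat (negPf xh1) /= eqxx addn0.
by rewrite take_size_cat.
Qed.

Section MatchingStrategy.
Context (G : sgraph) (pi : G -> G) (edge_pi : forall x, edge x (pi x)).
Let sigma := matching_strategy (fun x y => y == pi x).

Lemma matching_strategy_rcons (h : seq G) v :
  (pi v \notin rcons h v -> sigma (rcons h v) = Some (pi v)) /\
  (forall u, u \notin rcons h v -> edge v u ->
     exists2 w, edge v w & sigma (rcons h v) = Some w).
Proof.
have -> : sigma (rcons h v) = reply (fun x y => y == pi x) [predC rcons h v] v.
  by case: h => //= x h; rewrite last_rcons.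
rewrite /reply; split=> [pi_free|u u_free vu].
  by case: pick_lastP => [y /andP[_ /eqP->]//|/(_ (pi v))]; rewrite /= pi_free eqxx.
case: pick_lastP => [y /andP[_ /eqP->]|_]; first by exists (pi v).
case: pick_lastP => [y /andP[_ vy]|/(_ u)]; first by exists y.
by rewrite /= u_free vu.
Qed.

(* Suppose that Staller claims all of N[v], and let u be the predecessor of v
   under pi.  Had she claimed u before v, Dominator would have replied v to u;
   had she claimed v before u, Dominator would have replied to v in N[v]. *)
Lemma matching_strategy_winning (pi_inj : injective pi) first : winning first sigma.
Proof.
move=> h uniq_h foll ndom; have next_move h1 v x h2 :
    h = h1 ++ v :: x :: h2 -> ~~ dominator_turn first h1 ->
    [/\ v \notin h1, x \notin rcons h1 v & sigma (rcons h1 v) = Some x].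
  move=> hE turn; move: uniq_h; rewrite hE -cat_rcons.
  rewrite cat_uniq rcons_uniq /= => /and3P[/andP[vh1 _] /norP[xh _] _]; split=> //.
  by apply: (foll _ _ h2); rewrite ?dominator_turn_rcons// hE cat_rcons.
have claimed x : x \in h -> exists h1 h2, h = h1 ++ x :: h2.
  by case/splitPr => h1 h2; exists h1, h2.
have dom_rcons h1 x y h2 : h = h1 ++ x :: y :: h2 ->
    ~~ dominator_turn first h1 -> y \in dominator_set first h.
  move=> hE turn; have hE' : h = rcons h1 x ++ y :: h2 by rewrite cat_rcons.
  by rewrite hE' mem_dominator_set -?hE'// dominator_turn_rcons.
(* The essential point: on a full board some closed neighbourhood would belong entirely to Staller.
   Given a free vertex, the strategy always proposes one. *)
have lt_size : size h < #|G|.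
  rewrite ltnNge; apply/negP => full.
  have mem_h x : x \in h.
    suff /subsetP-> : predT \subset h by [].
    by rewrite -(geq_leqif (subset_leqif_card (subset_predT _))) (card_uniqP uniq_h).
  case/forallPn: ndom => v; rewrite negbK => /eqP/setP nbhd.
  have staller x : x == v \/ edge v x -> x \notin dominator_set first h.
    move=> /orP xv; have := nbhd x.
    by rewrite in_setI [x \in closed_nbhd v]inE xv andbT in_set0 => ->.
  pose u := finv pi v; have piu : pi u = v by rewrite f_finv.
  have vu : edge v u by rewrite edge_sym -piu.
  have [h1 [h2 hE]] := claimed _ (mem_h v).
  have turn1 : ~~ dominator_turn first h1.
    by rewrite -(@mem_dominator_set _ _ _ h2 v) -?hE// staller// eqxx; left.
  have uv : u != v by apply: contraTneq vu => ->; rewrite edge_irrefl.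
  have := mem_h u; rewrite {1}hE mem_cat inE (negPf uv) => /orP[uh1|uh2].
    case/splitPr: uh1 hE turn1 => a b hE turn1.
    have hE' : h = a ++ u :: (b ++ v :: h2) by rewrite hE -catA.
    have turn_a : ~~ dominator_turn first a.
      by rewrite -(@mem_dominator_set _ _ _ (b ++ v :: h2) u) -?hE'// staller//; right.
    (* If [v] comes right after [u], it is Dominator's. Otherwise [v] was still free when she
       answered [u] by [w], which forces [w = v] and a repetition in [h]. *)
    case: b hE' {hE turn1} => [|w b] hE'.
      have := staller v; rewrite (dom_rcons _ _ _ _ hE' turn_a) eqxx.
      by move=> /(_ (or_introl isT)).
    have vN : v \notin rcons a u /\ v != w.
      move: uniq_h; rewrite hE' (catA a [:: u, w & b]) uniq_catC /=.
      rewrite !mem_cat !inE !negb_or mem_rcons inE negb_or => /andP[].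
      by case/and4P=> _ -> -> /andP[-> _].
    have [_ _ sig] := next_move _ _ _ _ hE' turn_a.
    have := (matching_strategy_rcons a u).1; rewrite piu vN.1 sig => /(_ isT) [wv].
    by rewrite wv eqxx in vN; case: vN.
  (* Since [u] comes later, Dominator did move after [v], and the free neighbour [u] guarantees that
     her answer [w] is adjacent to [v]. *)
  case: h2 hE uh2 => // w h2 hE uh2.
  have [vh1 wh1 sig] := next_move _ _ _ _ hE turn1.
  have u_free : u \notin rcons h1 v.
    by move: uniq_h; rewrite hE -cat_rcons cat_uniq => /and3P[_ /hasPn/(_ u uh2)].
  have [w' vw' sig'] := (matching_strategy_rcons h1 v).2 _ u_free vu.
  have ww' : w = w' by apply: Some_inj; rewrite -sig -sig'.
  have := staller w; rewrite (dom_rcons _ _ _ _ hE turn1) ww'.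
  by move=> /(_ (or_intror vw')).
split=> // turn; have [x xh] : exists x, x \notin h.
  apply/existsP; rewrite -negb_forall; apply: contraL lt_size => /forallP mem_h.
  by rewrite -leqNgt -(card_uniqP uniq_h) subset_leq_card//; apply/subsetP => x _.
exact: matching_strategy_free xh.
Qed.
End MatchingStrategy.

(** * The orbits of a permutation as a perfect [1,2]-factor *)

Definition orbit_edge (T : finType) (pi : T -> T) : rel T :=
  fun x y => (y == pi x) || (x == pi y).

Lemma orbit_edge_component (T : finType) (pi : T -> T) x :
  injective pi -> component (orbit_edge pi) x = [set y in orbit pi x].
Proof.
move=> pi_inj; apply/setP => y; rewrite !inE -fconnect_orbit.
apply/idP/idP; apply: connect_sub => x1 y1.
  case/orP=> /eqP->; first exact: fconnect1.
  by rewrite fconnect_sym// fconnect1.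
by move=> /eqP <-; apply: connect1; rewrite /orbit_edge eqxx.
Qed.

Lemma iter_order_eq (T : finType) (pi : T -> T) x i j :
    injective pi -> i < order pi x -> j < order pi x ->
  (iter i pi x == iter j pi x) = (i == j).
Proof.
move=> pi_inj ix jx; rewrite -(nth_traject pi ix x) -(nth_traject pi jx x).
by rewrite nth_uniq ?size_traject// orbit_uniq.
Qed.

(** Iteration from [x] numbers the orbit, and [pi] becomes the successor modulo the order. Orders 1
    and 2 are included as degenerate cycles. *)
Lemma orbit_edge_cycle (T : finType) (pi : T -> T) x :
    injective pi ->
  induced_iso (orbit_edge pi) (component (orbit_edge pi) x)
    (@cycle_edge (order pi x)).
Proof.
move=> pi_inj; exists (fun i : 'I__ => iter i pi x); split.
- by move=> i j /eqP; rewrite iter_order_eq// => /eqP/val_inj.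
- rewrite orbit_edge_component//; apply/setP => y; rewrite inE.
  apply/imsetP/trajectP => [[i _ ->]|[i ix ->]]; first by exists i.
  by exists (Ordinal ix).
have iterS k : k < order pi x -> pi (iter k pi x) = iter (k.+1 %% order pi x) pi x.
  rewrite -iterS leq_eqVlt => /predU1P[->|kx]; last by rewrite modn_small.
  by rewrite modnn iter_order.
have mod_order k : k.+1 %% order pi x < order pi x by rewrite ltn_mod order_gt0.
by move=> i j; rewrite /orbit_edge /cycle_edge !iterS// !iter_order_eq.
Qed.

Lemma cycle_edge2 (i j : 'I_2) : cycle_edge i j = complete_edge i j.
Proof. by case: i j => -[|[]] // ? [[|[]]]. Qed.

Lemma orbit_edge_factor (G : sgraph) (pi : G -> G) :
  injective pi -> (forall x, edge x (pi x)) -> perfect_12_factor (orbit_edge pi).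
Proof.
move=> pi_inj edge_pi; split.
- by move=> x y; rewrite /orbit_edge orbC.
- by move=> x y /orP[]/eqP->//; rewrite edge_sym.
move=> x; have := orbit_edge_cycle x pi_inj.
(* An orbit of size 1 would be a vertex adjacent to itself. *)
have : 1 < order pi x.
  rewrite ltn_neqAle order_gt0 andbT; apply: contraTneq (edge_pi x) => order1.
  by have := iter_order pi_inj x; rewrite -order1 /= => ->; rewrite edge_irrefl.
case: (order pi x) => [|[|[|n]]] // _; last by right; exists n.+3.
by move=> [g [g_inj gA gE]]; left; exists g; split=> // i j; rewrite gE cycle_edge2.
Qed.

(** * The auction program *)

(* Array row holds the multiples of n, as the machine cannot multiply; own y is
   one plus the number of the owner of y, or 0, and cur and best are coded in the
   same way. *)
Local Notation row := 5 (only parsing).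
Local Notation own := 6 (only parsing).
Local Notation price := 7 (only parsing).
Local Notation cur := 8 (only parsing).
Local Notation best := 9 (only parsing).
Local Notation used := 10 (only parsing).
Local Notation claimed := 11 (only parsing).
Local Notation vi := 12 (only parsing).
Local Notation vj := 13 (only parsing).

Definition var (a : nat) : expr := Get a (Const 0).
Definition assign (a : nat) (e : expr) : cmd := Set_ a (Const 0) e.
Definition succ (e : expr) : expr := Add e (Const 1).
Definition pred_ (e : expr) : expr := Sub e (Const 1).
Definition differ (e1 e2 : expr) : expr := Add (Sub e1 e2) (Sub e2 e1).

Definition compute_rows : cmd :=
  for_ vi 0 (Set_ row (succ (var vi)) (Add (Get row (var vi)) (var 0))).

Definition find_unmatched : cmd :=
  Seq (assign cur (Const 0))
  (for_ vi 0
    (Seq (assign used (Const 0))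
    (Seq (for_ vj 0
           (If (differ (Get own (var vj)) (succ (var vi))) Skip
               (assign used (Const 1))))
         (If (var used) Skip (assign cur (succ (var vi))))))).

Definition adjacent (e1 e2 : expr) : expr := Get 1 (Add (Get row e1) e2).

Definition find_best : cmd :=
  Seq (assign best (Const 0))
  (for_ vj 0
    (If (adjacent (pred_ (var cur)) (var vj))
      (If (var best)
        (If (Sub (Get price (pred_ (var best))) (Get price (var vj)))
          (assign best (succ (var vj))) Skip)
        (assign best (succ (var vj))))
      Skip)).

Definition bid : cmd :=
  Seq find_best
  (Seq (Set_ own (pred_ (var best)) (var cur))
       (Set_ price (pred_ (var best)) (succ (Get price (pred_ (var best)))))).

Definition auction_program : cmd :=
  Seq compute_rows
  (Seq find_unmatched (While (var cur) (Seq bid find_unmatched))).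

Definition scan (e : expr) : cmd :=
  for_ vi 0 (If e (assign 4 (succ (var vi))) Skip).

Definition last_move : expr := Get 3 (pred_ (var 2)).

(** The scans run in increasing priority, each overwriting the output of the previous ones. The
    guard of the last one is nonzero exactly when both summands under the subtraction vanish: the
    vertex is unclaimed and owned by the last move. *)
Definition reply_program : cmd :=
  Seq (for_ vi 2 (Set_ claimed (Get 3 (var vi)) (Const 1)))
  (Seq (scan (Sub (Const 1) (Get claimed (var vi))))
  (Seq (scan (Sub (adjacent last_move (var vi)) (Get claimed (var vi))))
       (scan (Sub (Const 1) (Add (Get claimed (var vi))
                (differ (Get own (var vi)) (succ last_move))))))).

Lemma differ_eq0 m e1 e2 : (eval m (differ e1 e2) == 0) = (eval m e1 == eval m e2).
Proof. by rewrite /=; lia. Qed.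

Lemma enum_rank_nat_inj (T : finType) (x y : T) :
  (enum_rank x == enum_rank y :> nat) = (x == y).
Proof. by rewrite val_eqE (inj_eq enum_rank_inj). Qed.

Lemma move_code_eq_Some (G : sgraph) (o : option G) x :
  (move_code o == (enum_rank x).+1) = (o == Some x).
Proof. by case: o => //= y; rewrite eqSS enum_rank_nat_inj. Qed.

Lemma forall_rcons (T : eqType) (P : T -> Prop) s x :
  (forall y, y \in s -> P y) -> P x -> forall y, y \in rcons s x -> P y.
Proof. by move=> Ps Px y; rewrite mem_rcons inE => /predU1P[->|/Ps]. Qed.

(** * Correctness of the auction and reply programs *)

Section Programs.
Context (G : sgraph) (B : nat) (leB : #|G| <= B).
Implicit Types (m : memory) (o : G -> option G).

Lemma wp_compute_rows m :
    m 0 0 = #|G| -> m row 0 = 0 ->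
  wp B compute_rows m (fun m' => forall k, k <= #|G| -> m' row k = k * #|G|).
Proof.
move=> m0 row0; apply: (@wp_for _ _ _ _ _
  (fun j m => forall k, k <= j -> m row k = k * #|G|)); rewrite ?m0 //.
- by move=> k; rewrite /update /= leqn0 => /eqP->; rewrite row0.
- move=> k m1 kn off mi rowk; apply: wp_set => /= mi' j jk.
  rewrite /update /= mi addn1; case: eqVneq => [->|jk']; last by apply: rowk; lia.
  by rewrite rowk// (off 0) // m0 mulSn addnC.
Qed.

Definition unmatched_spec o (u : option G) :=
  if u is Some x then forall y, o y != Some x else forall x, exists y, o y = Some x.

Lemma wp_find_unmatched m o :
    m 0 0 = #|G| -> (forall y, m own (enum_rank y) = move_code (o y)) ->
  wp B find_unmatched m (fun m' =>
    exists2 u, m' cur 0 = move_code u & unmatched_spec o u).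
Proof.
move=> m0 m_own; apply/wp_seq/wp_set => /=; set m1 := update _ _ _ _.
pose I (s : seq G) (m : memory) := exists2 u, m cur 0 = move_code u &
  if u is Some x then forall y, o y != Some x
  else forall x, x \in s -> exists y, o y = Some x.
apply: (@wp_foreach G _ _ _ _ _ I) => //.
- by exists None.
- move=> s x m2 off2 mi [u mcur uP].
  apply/wp_seq/wp_set/wp_seq => /=; set m3 := update _ _ _ _.
  (* The flag records whether [x] owns one of the vertices scanned so far. *)
  pose J (s : seq G) (m : memory) := m used 0 = has (fun y => o y == Some x) s.
  apply: (@wp_foreach G _ _ _ _ _ J) => //.
  + by rewrite /m3 /update /= (off2 0).
  + move=> s' y m4 off4 mj; rewrite /J has_rcons => m_used.
    have e0 : (eval m4 (differ (Get own (var vj)) (succ (var vi))) == 0)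
            = (o y == Some x).
      rewrite differ_eq0 /= mj !(off4 vi)// !(off4 own)// /m3 /update /= mi addn1.
      by rewrite (off2 own)// /m1 /update /= m_own move_code_eq_Some.
    apply: wp_if => [ne|eq]; [apply: wp_skip|apply: wp_set] => _;
      rewrite /update /= -e0.
      by rewrite (negPf ne) m_used.
    by rewrite eq eqxx.
  + move=> m4 off4; rewrite /J => m_used.
    have m4cur : m4 cur 0 = move_code u by rewrite (off4 cur).
    apply: wp_if => /=; rewrite m_used.
      rewrite eqb0 negbK => /hasP[y _ /eqP oy]; apply: wp_skip => _.
      exists u => //; case: u uP {mcur m4cur} => //= uP.
      by apply: forall_rcons => //; exists y.
    move=> /eqP; rewrite eqb0 => /hasPn xfree; apply: wp_set => /= _.
    exists (Some x) => [|y]; last by apply: xfree; rewrite mem_enum.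
    by rewrite /update /= (off4 vi)// /m3 /update /= mi addn1.
- move=> m2 _ [u m2cur uP]; exists u => //; case: u uP {m2cur} => //= uP x.
  by apply: uP; rewrite mem_enum.
Qed.

Definition graph_memory m :=
  [/\ m 0 0 = #|G|,
      forall x y : G, m 1 (enum_rank x * #|G| + enum_rank y) = edge x y
    & forall x : G, m row (enum_rank x) = enum_rank x * #|G|].

Lemma eval_adjacent m (x y : G) e1 e2 :
    graph_memory m -> eval m e1 = enum_rank x -> eval m e2 = enum_rank y ->
  eval m (adjacent e1 e2) = edge x y.
Proof. by move=> [_ adjm rowm] /= -> ->; rewrite rowm adjm. Qed.

Lemma graph_memory_agree W m m' :
    all (fun a => a \notin W) [:: 0; 1; row] -> agree_off W m m' ->
  graph_memory m -> graph_memory m'.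
Proof.
move=> /and4P[w0 w1 w5 _] off [m0 adjm rowm].
by split=> [|x y|x]; rewrite off.
Qed.

Lemma wp_find_best m x (p : G -> nat) :
    graph_memory m -> m cur 0 = (enum_rank x).+1 ->
    (forall y, m price (enum_rank y) = p y) -> (exists y, edge x y) ->
  wp B find_best m (fun m' => exists2 y, m' best 0 = (enum_rank y).+1 &
    edge x y /\ forall y', edge x y' -> p y <= p y').
Proof.
move=> gm mcur mprice [y0 xy0]; apply/wp_seq/wp_set => /=; set m1 := update _ _ _ _.
have gm1 : graph_memory m1 by [].
pose I (s : seq G) (m : memory) := exists2 b, m best 0 = move_code b &
  if b is Some y then edge x y /\ forall y', y' \in s -> edge x y' -> p y <= p y'
  else forall y', y' \in s -> ~~ edge x y'.
apply: (@wp_foreach G _ _ _ _ _ I) => //.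
- by case: gm.
- by exists None.
- move=> s y m2 off2 mj [b mbest bP].
  have gm2 : graph_memory m2 by exact: graph_memory_agree off2 gm1.
  have m2price z : m2 price (enum_rank z) = p z by rewrite (off2 price)// -mprice.
  have m2cur : m2 cur 0 = (enum_rank x).+1 by rewrite (off2 cur).
  have adjE : eval m2 (adjacent (pred_ (var cur)) (var vj)) = edge x y.
    by apply: eval_adjacent => //=; rewrite m2cur subn1.
  have set_best : edge x y ->
      (forall y', y' \in s -> edge x y' -> p y <= p y') ->
      wp B (assign best (succ (var vj))) m2
        (fun m' => m' vj 0 = enum_rank y ->
           I (rcons s y) (update m' vj 0 (enum_rank y).+1)).
    move=> xy ymin; apply: wp_set => /= _; exists (Some y).
      by rewrite /update /= mj addn1.
    by split=> //; apply: forall_rcons.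
  apply: wp_if; rewrite adjE; last first.
    move=> /eqP; rewrite eqb0 => nxy; apply: wp_skip => _; exists b => //.
    case: b bP {mbest} => [z [xz zmin]|nos]; last exact: forall_rcons.
    by split=> //; apply: forall_rcons => //; rewrite (negPf nxy).
  rewrite eqb0 negbK => xy; apply: wp_if; rewrite /= mbest.
    case: b bP mbest => //= z [xz zmin] mbest _; apply: wp_if => /=;
      rewrite mbest mj subn1 /= !m2price => le_p.
      by apply: set_best => // y' /zmin h /h; lia.
    apply: wp_skip => _; exists (Some z) => //; split=> //.
    by apply: forall_rcons => // _; lia.
  case: b bP {mbest} => //= nos _; apply: set_best => // y' /nos.
  by move=> /negP.
- move=> m2 off2 [[y|] m2best]; last first.
    by move=> /(_ y0); rewrite mem_enum xy0 => /(_ isT).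
  move=> [xy ymin]; exists y => //; split=> // y'.
  by apply: ymin; rewrite mem_enum.
Qed.

Definition auction_memory m o (p : G -> nat) :=
  (forall y, m own (enum_rank y) = move_code (o y)) /\
  (forall y, m price (enum_rank y) = p y).

(** The unit increase of the total price is what makes the main loop terminate. A cheapest neighbour
    exists because the degree is positive. *)
Lemma wp_bid r m o (p : G -> nat) x :
    1 <= r -> regular r G -> auction o p -> graph_memory m ->
    auction_memory m o p -> m cur 0 = (enum_rank x).+1 ->
    (forall y, o y != Some x) ->
  wp B bid m (fun m' => exists o' p',
    [/\ auction o' p', auction_memory m' o' p'
      & \sum_(y : G) p' y = (\sum_(y : G) p y).+1]).
Proof.
move=> r_gt0 regG aop gm [m_own m_price] mcur xfree.
have has_nbr : exists y, edge x y.
  have /card_gt0P[y] : 0 < #|[set y | edge x y]| by rewrite regG.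
  by rewrite inE; exists y.
apply/wp_seq/(wp_conseq (wp_find_best gm mcur m_price has_nbr)).
move=> m1 off1 [y m1best [xy ymin]]; apply/wp_seq/wp_set/wp_set => /=.
rewrite /update /= m1best subn1 /= (off1 cur)// mcur (off1 price)// m_price addn1.
do 2!eexists; split; first exact: auction_bid r_gt0 regG aop xfree xy ymin.
  by split=> z; rewrite enum_rank_nat_inj /=; case: eqP => // _;
    rewrite ?(off1 own) ?(off1 price).
rewrite (bigD1 y) //= eqxx [in RHS](bigD1 y) //= addSn; congr (_ + _).+1.
by apply: eq_bigr => z /negPf ->.
Qed.

Lemma wp_auction_program r m :
    1 <= r -> regular r G -> #|G| * #|G| <= B -> m 0 0 = #|G| ->
    (forall x y : G, m 1 (enum_rank x * #|G| + enum_rank y) = edge x y) ->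
    (forall a, row <= a -> m a =1 fun=> 0) ->
  wp B auction_program m (fun m' => graph_memory m' /\ exists2 pi : G -> G,
    injective pi /\ (forall x, edge x (pi x))
    & forall x y, (m' own (enum_rank y) == (enum_rank x).+1) = (y == pi x)).
Proof.
move=> r_gt0 regG leBB m0 adjm zero; have row0 : m row 0 = 0 by rewrite zero.
apply/wp_seq/(wp_conseq (wp_compute_rows m0 row0)) => m1 off1 m1row.
have gm1 : graph_memory m1.
  split=> [|x y|x]; rewrite ?(off1 0) ?(off1 1)//.
  by rewrite m1row// ltnW.
have am1 : auction_memory m1 (fun=> None) (fun=> 0).
  by split=> y; [rewrite (off1 own)|rewrite (off1 price)]; rewrite ?zero.
apply/wp_seq; case: (gm1) => m10 _ _.
apply: (wp_conseq (wp_find_unmatched m10 am1.1)) => m2 off2 [u m2cur uP].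
have gm2 : graph_memory m2 by apply: graph_memory_agree off2 gm1.
pose I m o p := [/\ auction o p, auction_memory m o p, graph_memory m &
  exists2 u, m cur 0 = move_code u & unmatched_spec o u].
have I2 : I m2 (fun=> None) (fun=> 0).
  split=> //; last by exists u.
  by split=> y; rewrite ?(off2 own) ?(off2 price) ?am1.1 ?am1.2.
(* The number of bids still possible: each of the [#|G|] prices is at most [#|G|]. *)
pose mu m := #|G| * #|G| - \sum_(y : G) m price (enum_rank y).
apply: (@wp_while _ _ _ _ (fun m => exists o p, I m o p) mu).
- by do 2!eexists; exact: I2.
- by rewrite (leq_trans (leq_subr _ _)).
- move=> m3 _ [o [p [aop am gm [v m3cur vP]]]]; rewrite /= m3cur.
  case: v m3cur vP => //= x m3cur xfree _.
  apply/wp_seq/(wp_conseq (wp_bid r_gt0 regG aop gm am m3cur xfree)).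
  move=> m4 off4 [o' [p' [aop' am' sumE]]].
  have gm4 : graph_memory m4 by apply: graph_memory_agree off4 gm.
  case: (gm4) => m40 _ _.
  apply: (wp_conseq (wp_find_unmatched m40 am'.1)) => m5 off5 m5cur.
  have priceE m' o1 p1 : auction_memory m' o1 p1 ->
      \sum_(y : G) m' price (enum_rank y) = \sum_(y : G) p1 y.
    by move=> [_ m_price]; apply: eq_bigr.
  have am5 : auction_memory m5 o' p'.
    by split=> y; rewrite ?(off5 own) ?(off5 price) ?am'.1 ?am'.2.
  split.
    exists o', p'; split=> //; last by apply: graph_memory_agree off5 gm4.
  rewrite /mu (priceE _ _ _ am) (priceE _ _ _ am5).
  (* The bound on the total after the bid ensures that the truncated subtraction in [mu] really
     decreases. *)
  have : \sum_(y : G) p' y <= #|G| * #|G|.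
    by rewrite -sum_nat_const; apply: leq_sum => y _; apply: auction_bounded aop' _.
  by rewrite sumE; lia.
- move=> m3 _ [o [p [aop am gm [[v|] m3cur vP]]]]; rewrite /= m3cur// => _.
  have [pi piP oE] := auction_perfect aop vP; split=> //; exists pi => // x y.
  by rewrite am.1 move_code_eq_Some.
Qed.

Lemma wp_scan m e (P : pred G) (u : option G) :
    m 0 0 = #|G| -> m 4 0 = move_code u ->
    (forall m' y, agree_off [:: vi; 4] m m' -> m' vi 0 = enum_rank y ->
       (eval m' e != 0) = P y) ->
  wp B (scan e) m (fun m' =>
    agree_off [:: vi; 4] m m' /\ m' 4 0 = move_code (pick_last P u)).
Proof.
move=> m0 m4 eP; apply: (@wp_foreach G _ _ _ _ _ (fun s m => m 4 0 =
  move_code (foldl (fun b y => if P y then Some y else b) u s))) => //.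
move=> s y m1 off mi m14; rewrite foldl_rcons -(eP m1 y off mi).
apply: wp_if => [ne|e0]; [apply: wp_set => _|apply: wp_skip => _].
  by rewrite ne /update /= mi addn1.
by rewrite e0.
Qed.

Lemma wp_reply_program m (next : rel G) (h : seq G) :
    uniq h -> h != [::] -> graph_memory m ->
    (forall x y, (m own (enum_rank y) == (enum_rank x).+1) = next x y) ->
    m 2 0 = size h -> m 3 =1 input h 3 -> m 4 0 = 0 -> m claimed =1 (fun=> 0) ->
  wp B reply_program m (fun m' => m' 4 0 = move_code (matching_strategy next h)).
Proof.
move=> uniq_h h0 gm m_own m2 m3 m4 m_claimed.
have h_gt0 : 0 < size h by case: h h0 {uniq_h m2 m3}.
have [z ->] : exists z, matching_strategy next h = reply next [predC h] (last z h).
  by case: h h0 {uniq_h m2 m3 h_gt0} => // z h _; exists z.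
have last_h : m 3 (size h).-1 = enum_rank (last z h).
  by rewrite m3 /input (nth_map z) ?nth_last ?prednK.
have m3_nth k : k < size h -> m 3 k = enum_rank (nth z h k).
  by move=> kh; rewrite m3 /input (nth_map z).
have size_h : size h <= #|G| by rewrite -(card_uniqP uniq_h) max_card.
(* After [k] rounds, [claimed] is the indicator of the first [k] moves. *)
apply/wp_seq/(@wp_for _ _ _ _ _ (fun k m => forall x : G,
  m claimed (enum_rank x) = (x \in take k h))) => //.
- by rewrite m2 (leq_trans size_h).
- by move=> x; rewrite take0 /update /= m_claimed.
- move=> k m1; rewrite m2 => kh off mi m1c; apply: wp_set => /= _ x.
  rewrite /update /= mi (off 3)// m3_nth// enum_rank_nat_inj (take_nth z)//.
  by rewrite mem_rcons inE m1c; case: eqP.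
rewrite m2 take_size => m1 off1 m1c.
have gm1 : graph_memory m1 by apply: graph_memory_agree off1 gm.
have m1_own x y : (m1 own (enum_rank y) == (enum_rank x).+1) = next x y.
  by rewrite (off1 own).
have m1_last m' : m' 2 =1 m1 2 -> m' 3 =1 m1 3 ->
    eval m' last_move = enum_rank (last z h).
  by move=> m'2 m'3; rewrite /= m'2 (off1 2)// m2 m'3 (off1 3)// subn1 last_h.
have wp_scan1 m' e (P : pred G) (u : option G) :
    agree_off [:: vi; 4] m1 m' -> m' 4 0 = move_code u ->
    (forall m'' y, agree_off [:: vi; 4] m1 m'' -> m'' vi 0 = enum_rank y ->
       (eval m'' e != 0) = P y) ->
    wp B (scan e) m' (fun m'' =>
      agree_off [:: vi; 4] m1 m'' /\ m'' 4 0 = move_code (pick_last P u)).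
  move=> off m'4 eP; have m'0 : m' 0 0 = #|G| by rewrite (off 0)//; case: gm1.
  apply: (wp_conseq (wp_scan m'0 m'4 _)) => [m'' y off'|m'' _ [off' out]].
    by apply: eP; apply: agree_off_trans off off'.
  by split=> //; apply: agree_off_trans off off'.
apply/wp_seq/(wp_conseq (wp_scan1 m1 _ [predC h] None _ _ _)) => //=.
- by rewrite (off1 4).
- by move=> m' y off mi; rewrite /= mi (off claimed)// m1c; case: (y \in h).
move=> m5 _ [off5 m54].
apply/wp_seq/(wp_conseq (wp_scan1 m5 _
  [pred y | y \notin h & edge (last z h) y] _ off5 m54 _)).
- move=> m' y off mi.
  have gm' : graph_memory m' by apply: graph_memory_agree off gm1.
  have evalSub e1 e2 : eval m' (Sub e1 e2) = eval m' e1 - eval m' e2 by [].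
  rewrite evalSub (eval_adjacent gm' (m1_last m' (off 2 isT) (off 3 isT))
    (mi : eval m' (var vi) = _)) /= mi.
  by rewrite (off claimed)// m1c; case: (y \in h); case: edge.
move=> m6 _ [off6 m64].
apply: wp_conseq (wp_scan1 m6 _
  [pred y | y \notin h & next (last z h) y] _ off6 m64 _) _ => [|m' _ []//].
move=> m' y off mi; set d := differ _ _.
have d0 : (eval m' d == 0) = next (last z h) y.
  rewrite differ_eq0 -[eval _ (succ _)]/(eval m' last_move + 1).
  by rewrite (m1_last m' (off 2 isT) (off 3 isT)) /= mi addn1 (off own).
rewrite -[eval _ _]/(1 - (m' claimed (m' vi 0) + eval m' d)) mi (off claimed)// m1c.
by rewrite [RHS]/= -d0; case: (y \in h); case: (eval m' d).
Qed.
End Programs.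

(** * The encoded input and the assembled theorem *)

Lemma input_edge (G : sgraph) (h : seq G) (x y : G) :
  input h 1 (enum_rank x * #|G| + enum_rank y) = edge x y.
Proof.
congr nat_of_bool; apply/existsP/idP => [[x' /existsP[y' /andP[xy' /eqP eq]]]|xy].
  have G_gt0 : 0 < #|G| by apply/card_gt0P; exists x.
  (* Ranks are below [#|G|], so quotient and remainder recover both vertices from the cell
     number. *)
  have := congr1 (divn^~ #|G|) eq; have := congr1 (modn^~ #|G|) eq.
  rewrite !modnMDl !modn_small// !divnMDl// !divn_small// !addn0.
  by move=> /eqP + /eqP; rewrite !enum_rank_nat_inj => /eqP-> /eqP->.
by exists x; apply/existsP; exists y; rewrite xy eqxx.
Qed.

Lemma wp_auction_input r (G : sgraph) B :
    1 <= r -> regular r G -> #|G| <= B -> #|G| * #|G| <= B ->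
  wp B auction_program (input ([::] : seq G)) (fun m => graph_memory G m /\
    exists2 pi : G -> G, injective pi /\ (forall x, edge x (pi x))
    & forall x y, (m own (enum_rank y) == (enum_rank x).+1) = (y == pi x)).
Proof.
move=> r_gt0 regG leB leBB; apply: wp_auction_program r_gt0 regG _ _ _ _ => //.
- exact: input_edge.
- by do 5!case=> //.
Qed.

Theorem corollary3p5 :
  (forall (r : nat) (G : sgraph), 1 <= r -> regular r G ->
     (exists f : rel G, perfect_12_factor f) /\ outcome_D G)
  /\
  (exists (prog : cmd) (c d : nat),
   forall (r : nat) (G : sgraph), 1 <= r -> regular r G ->
     exists sigma : strategy G,
       winning Staller sigma /\
       computes_within prog (fun n => c * n ^ d + c) sigma).
Proof.
split=> [r G r_gt0 regG|].
  (* Existence of [pi] is read off the terminating run of the auction on the empty position. *)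
  have [_ [_ [_ _ [_ [pi [pi_inj edge_pi] _]]]]] :=
    wp_auction_input r_gt0 regG (leq_addl (#|G| * #|G|) #|G|) (leq_addr _ _).
  split; first by exists (orbit_edge pi); apply: orbit_edge_factor.
  by move=> first; exists (matching_strategy (fun x y => y == pi x));
    apply: matching_strategy_winning.
(* This bound covers both the at most [n * n] bids and the loops over at most [n] vertices or
   moves. *)
pose prog := Seq auction_program reply_program; pose B n := n * n + n.
have /(poly_bounded_time prog)/poly_bounded_monomial[c [d time_le]] : poly_bounded B.
  exact: poly_bounded_add (poly_bounded_mul poly_bounded_id poly_bounded_id)
    poly_bounded_id.
exists prog, c, d => r G r_gt0 regG.
have leB : #|G| <= B #|G| := leq_addl _ _.
have [t1 [m1 [ex1 le1 [gm1 [pi [pi_inj edge_pi] pi_own]]]]] :=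
  wp_auction_input r_gt0 regG leB (leq_addr _ _).
exists (matching_strategy (fun x y => y == pi x)); split.
  exact: matching_strategy_winning.
move=> h uniq_h turn.
suff [t [m [ex le_t out]]] : wp (B #|G|) prog (input h) (fun m =>
    m 4 0 = move_code (matching_strategy (fun x y => y == pi x) h)).
  by exists t, m; split=> //; apply: leq_trans le_t _.
(* The auction ignores the arrays 2, 3 and 4, so that it yields the same pi
   whatever the position. *)
have [m2 ex2 m12] : exists2 m2, exec auction_program (input h) t1 m2 &
    forall a, a \notin [:: 2; 3; 4] -> m1 a =1 m2 a.
  apply: (exec_noninterference (P := [pred a | a \notin [:: 2; 3; 4]]) ex1) => //.
  by do 5?case=> //.
have off2 := exec_agree_off ex2.
apply: wp_seq; exists t1, m2; split=> //; apply: wp_reply_program => //.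
- by case: h turn {uniq_h ex2 off2}.
- by apply: (@graph_memory_agree _ [:: 2; 3; 4] m1) => // a /m12 h12 i; rewrite h12.
- by move=> x y; rewrite -m12// pi_own.
- by rewrite off2.
- by apply: off2.
- by rewrite off2.
- by move=> i; rewrite off2.
Qed.
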